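(* (Daehee formula) Let $q\in\mathbb{C}$ with $|q|<1$. For $x\in\mathbb{R}$, $$e_q(ix)=\cos_q x+i\,\sin_q x .$$
   Context: Notation: $[n]_q=\frac{1-q^n}{1-q}=1+q+\cdots+q^{n-1}$, $[n]_q!=[n]_q[n-1]_q\cdots[1]_q$, $[0]_q!=1$, $i=\sqrt{-1}$. The $q$-exponential is $e_q(z)=\sum_{n=0}^{\infty}\frac{z^n}{[n]_q!}$, and the $q$-sine and $q$-cosine are defined by $$\sin_q x=\sum_{n=0}^{\infty}\frac{(-1)^n x^{2n+1}}{[2n+1]_q!},\qquad \cos_q x=\sum_{n=0}^{\infty}\frac{(-1)^n x^{2n}}{[2n]_q!}.$$ *)

(* Defs.v *)
From mathcomp Require Import all_boot all_order all_algebra complex.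
From mathcomp Require Import boolp classical_sets reals topology normedtype sequences.

Set Implicit Arguments.
Unset Strict Implicit.
Unset Printing Implicit Defensive.

Import Order.TTheory GRing.Theory Num.Theory.
Import numFieldNormedType.Exports.

Local Open Scope classical_set_scope.
Local Open Scope ring_scope.

Definition q_int (K : fieldType) (q : K) (n : nat) : K :=
  (1 - q ^+ n) / (1 - q).

Definition q_fact (K : fieldType) (q : K) (n : nat) : K :=
  \prod_(1 <= k < n.+1) q_int q k.

(* The three functions below are sums of series over an arbitrary numeric
   field K, to be used with K = R[i], on which the topology is not inferred
   directly.  `limn` returns 0 when the partial sums do not converge.  Over
   R[i] with `|q| < 1, we have q_fact q n != 0 and `|q_fact q n| is bounded
   above and below by positive constants times `|1 - q| ^- n, so each of the
   three series converges for `|(1 - q) * z| < 1 and diverges otherwise. *)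

Definition q_exp (K : numFieldType) (q z : K) : K :=
  limn (series (fun n : nat => z ^+ n / q_fact q n)).

Definition q_sin (K : numFieldType) (q z : K) : K :=
  limn (series (fun n : nat =>
    (-1) ^+ n * z ^+ (2 * n + 1) / q_fact q (2 * n + 1))).

Definition q_cos (K : numFieldType) (q z : K) : K :=
  limn (series (fun n : nat =>
    (-1) ^+ n * z ^+ (2 * n) / q_fact q (2 * n))).

(* Main.v *)
(* The even terms of the series of e_q(ix) are the terms of cos_q x, and the odd
   ones are i times the terms of sin_q x.  The products of the |1 - q^k| stay
   between two positive constants, so the norms of the terms are comparable to
   r^n with r = |(1 - q) x|.  If r < 1, all three series converge absolutely and
   the sum splits.  If r >= 1, none of them has terms tending to 0, so all three
   diverge and the identity holds between the junk values 0 of [limn]. *)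

Require Import Defs.
From mathcomp Require Import all_boot all_order all_algebra complex.
From mathcomp Require Import boolp classical_sets reals topology normedtype sequences.
From mathcomp Require Import exp ring lra.
Set Implicit Arguments.
Unset Strict Implicit.
Unset Printing Implicit Defensive.

Import Order.TTheory GRing.Theory Num.Theory.
Import numFieldNormedType.Exports.
Import ComplexField.Normc.
Local Open Scope ring_scope.
Local Open Scope complex_scope.
Local Open Scope classical_set_scope.

Lemma normc_ge0 (R : rcfType) (z : R[i]) : 0 <= normc z.
Proof. by case: z => a b; exact: sqrtr_ge0. Qed.

Lemma normrE (R : rcfType) (z : R[i]) : `|z| = (normc z)%:C.
Proof. by case: z. Qed.

Lemma normc_real (R : rcfType) (x : R) : normc x%:C = `|x|.
Proof. by rewrite /= expr0n addr0 sqrtr_sqr. Qed.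

Lemma normc_i (R : rcfType) : normc ('i%C : R[i]) = 1.
Proof. by rewrite /= expr0n add0r expr1n sqrtr1. Qed.

Lemma normc_Re (R : rcfType) (z : R[i]) : `|complex.Re z| <= normc z.
Proof. by rewrite -lecR -normrE; exact: normc_ge_Re. Qed.

Lemma normc_Im (R : rcfType) (z : R[i]) : `|complex.Im z| <= normc z.
Proof.
by case: z => a b; rewrite -sqrtr_sqr ler_wsqrtr//= lerDr sqr_ge0.
Qed.

Lemma normcX (R : rcfType) (z : R[i]) n : normc (z ^+ n) = normc z ^+ n.
Proof.
by elim: n => [|n IHn]; rewrite ?expr0 ?normc1// !exprS normcM IHn.
Qed.

Lemma normcB1_bounds (R : rcfType) (z : R[i]) :
  1 - normc z <= normc (1 - z) <= 1 + normc z.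
Proof.
rewrite -!lecR rmorphB rmorphD rmorph1 -!normrE.
have := lerB_dist (1 : R[i]) z; have := ler_normB (1 : R[i]) z.
by rewrite normr1 => -> ->.
Qed.

(** Each factor satisfies 1 + y <= exp y, so the product is at most the exponential of a geometric
    sum, and this sum is bounded uniformly in n. *)
Lemma prod_1DX_le (R : realType) (c a : R) n : 0 <= c -> 0 <= a < 1 ->
  \prod_(1 <= k < n.+1) (1 + c * a ^+ k) <= expR (c / (1 - a)).
Proof.
move=> c0 /andP[a0 a1].
have d0 : 0 < 1 - a by rewrite subr_gt0.
(* For the induction the exponent must depend on n: it is the sum of c a^k for 0 <= k <= n, the term
   k = 0 being slack. *)
suff H : \prod_(1 <= k < n.+1) (1 + c * a ^+ k)
    <= expR (c / (1 - a) * (1 - a ^+ n.+1)).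
  apply: (le_trans H); rewrite ler_expR ler_piMr ?divr_ge0 ?(ltW d0)//.
  by rewrite gerBl exprn_ge0.
elim: n => [|n IHn].
  by rewrite big_geq// expr1 mulfVK ?gt_eqF// -expR0 ler_expR.
rewrite big_nat_recr//=.
have -> : c / (1 - a) * (1 - a ^+ n.+2) =
    c / (1 - a) * (1 - a ^+ n.+1) + c * a ^+ n.+1.
  by rewrite [a ^+ n.+2]exprS; field; rewrite gt_eqF.
rewrite expRD ler_pM ?expR_ge1Dx//.
  by apply: prodr_ge0 => k _; rewrite addr_ge0 ?mulr_ge0 ?exprn_ge0.
by rewrite addr_ge0 ?mulr_ge0 ?exprn_ge0.
Qed.

Lemma q_fact_prod (K : fieldType) (q : K) n : q != 1 ->
  q_fact q n = (\prod_(1 <= k < n.+1) (1 - q ^+ k)) / (1 - q) ^+ n.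
Proof.
move=> q1; rewrite /q_fact /q_int; elim: n => [|n IHn].
  by rewrite !big_geq// expr0 divr1.
by rewrite !(big_nat_recr n.+1)//= IHn [(1 - q) ^+ n.+1]exprSr invfM mulrACA.
Qed.

(* Both |1 - q^k| and its inverse are at most 1 + |q|^k / (1 - |q|). *)
Lemma prod_1BX_normc_bounds (R : realType) (q : R[i]) : normc q < 1 ->
  exists2 B : R, 0 < B & forall n,
    B^-1 <= normc (\prod_(1 <= k < n.+1) (1 - q ^+ k)) <= B.
Proof.
set a := normc q => a1; have a0 : 0 <= a := normc_ge0 q.
set c := (1 - a)^-1.
have d0 : 0 < 1 - a by rewrite subr_gt0.
have c1 : 1 <= c by rewrite invf_ge1// gerBl.
have c0 : 0 <= c by rewrite (le_trans ler01).
exists (expR (c / (1 - a))); first exact: expR_gt0.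
move=> n; set e := fun k => 1 + c * a ^+ k.
have e0 k : 0 < e k by rewrite ltr_pwDl// mulr_ge0 ?exprn_ge0.
have P0 : 0 < \prod_(1 <= k < n.+1) e k by apply: prodr_gt0.
have PB : \prod_(1 <= k < n.+1) e k <= expR (c / (1 - a)).
  by apply: prod_1DX_le => //; rewrite a0.
have nP : normc (\prod_(1 <= k < n.+1) (1 - q ^+ k)) =
    \prod_(1 <= k < n.+1) normc (1 - q ^+ k).
  by apply: (big_morph _ (@normcM R) (@normc1 R)).
have eB k : (0 < k)%N -> (e k)^-1 <= normc (1 - q ^+ k) <= e k.
  move=> k0; have /andP[lb ub] := normcB1_bounds (q ^+ k).
  rewrite normcX -/a in lb ub.
  have y0 : 0 <= a ^+ k by rewrite exprn_ge0.
  have ya : a ^+ k <= a by rewrite -[leRHS]expr1 ler_wiXn2l// ltW.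
  apply/andP; split; last first.
    by apply: (le_trans ub); rewrite lerD2l ler_peMl.
  apply: le_trans lb; rewrite -[_^-1]mul1r ler_pdivrMr// /e.
  have h : 1 <= c * (1 - a ^+ k).
    by rewrite mulrC ler_pdivlMr// mul1r lerD2l lerN2.
  (* The goal follows from (1 + c y) (1 - y) = 1 + y (c (1 - y) - 1) with y = a^k. *)
  have : 0 <= a ^+ k * (c * (1 - a ^+ k) - 1).
    by rewrite mulr_ge0// subr_ge0.
  by lra.
rewrite nP; apply/andP; split.
  apply: (@le_trans _ _ (\prod_(1 <= k < n.+1) e k)^-1).
    by rewrite lef_pV2// posrE expR_gt0.
  rewrite -prodfV big_nat_cond [leRHS]big_nat_cond; apply: ler_prod => k.
  by rewrite andbT => /andP[/eB/andP[-> _] _]; rewrite invr_ge0 ltW.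
apply: le_trans PB; rewrite big_nat_cond [leRHS]big_nat_cond.
apply: ler_prod => k.
by rewrite andbT normc_ge0 => /andP[/eB/andP[_ ->] _].
Qed.

(** The term equals ((1 - q) z)^n divided by the product of the 1 - q^k. The interval from B^-1 to B
    is stable under inversion, so the same B serves. *)
Lemma q_exp_term_bounds (R : realType) (q : R[i]) : normc q < 1 ->
  exists2 B : R, 0 < B & forall (z : R[i]) n,
    B^-1 * normc ((1 - q) * z) ^+ n <= normc (z ^+ n / q_fact q n)
      <= B * normc ((1 - q) * z) ^+ n.
Proof.
move=> q1; have [B B0 PB] := prod_1BX_normc_bounds q1.
have qN1 : q != 1 by apply: contraTneq q1 => ->; rewrite normc1 ltxx.
exists B => // z n; have /andP[lb ub] := PB n.
have -> : normc (z ^+ n / q_fact q n) = normc ((1 - q) * z) ^+ n *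
    (normc (\prod_(1 <= k < n.+1) (1 - q ^+ k)))^-1.
  rewrite -normcX -normcV -normcM q_fact_prod// invf_div mulrCA mulrA.
  by rewrite exprMn.
have Z0 : 0 <= normc ((1 - q) * z) ^+ n by rewrite exprn_ge0 ?normc_ge0.
set p := normc (\prod_(_ <= k < _) _) in lb ub *.
have p0 : 0 < p by apply: lt_le_trans lb; rewrite invr_gt0.
rewrite [X in X <= _ <= _]mulrC [X in _ <= _ <= X]mulrC !ler_wpM2l//.
  by rewrite -[leRHS]invrK lef_pV2 ?posrE ?invr_gt0.
by rewrite lef_pV2 ?posrE.
Qed.

(** Among the indices below n, [uphalf n] are even and [n./2] are odd. *)
Lemma series_even_odd (V : zmodType) (u : nat -> V) n :
  series u n = series (fun k => u (2 * k)%N) (uphalf n) +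
               series (fun k => u (2 * k + 1)%N) n./2.
Proof.
elim: n => [|n IHn]; first by rewrite /series /= !big_geq// addr0.
rewrite seriesSr {}IHn /= uphalf_half.
have := odd_double_half n; case: (odd n) => /= nE.
  by rewrite add1n !seriesSr -!addrA mul2n addnC nE.
by rewrite add0n in nE *; rewrite seriesSr mul2n nE addrAC.
Qed.

(** Both [uphalf n] and [n./2] tend to infinity with n, so the two pieces of the partial sum keep
    their limits. *)
Lemma cvg_series_even_odd (K : numFieldType) (V : normedModType K)
    (u : V ^nat) (a b : V) :
  series (fun k => u (2 * k)%N) @ \oo --> a ->
  series (fun k => u (2 * k + 1)%N) @ \oo --> b ->
  series u @ \oo --> a + b.
Proof.
move=> ua ub.
rewrite (_ : series u = (series (fun k => u (2 * k)%N) \o uphalf) \+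
  (series (fun k => u (2 * k + 1)%N) \o half)); last first.
  by apply/funext => n; exact: series_even_odd.
have half_oo : n./2 @[n --> \oo] --> \oo.
  apply/cvgnyPge => A; near=> n.
  by rewrite -[A]doubleK half_leq//; near: n; exact: nbhs_infty_ge.
apply: cvgD; apply: cvg_comp; [|exact: ua|exact: half_oo|exact: ub].
apply/cvgnyPge => A; near=> n; rewrite uphalf_half.
apply: leq_trans (leq_addl _ _).
by near: n; move/cvgnyPge: half_oo; apply.
Unshelve. all: end_near. Qed.

Lemma cvg_complex (R : realType) (K := R[i] : numFieldType) (u : nat -> K) :
  cvgn (fun n => complex.Re (u n)) -> cvgn (fun n => complex.Im (u n)) ->
  cvgn u.
Proof.
move=> /cvg_ex[a ua] /cvg_ex[b ub]; apply/cvg_ex; exists (a +i* b : K).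
apply/cvgrPdist_lt => e e0.
(* The norm of K takes its values in K, so the radius e is a complex number; being positive, it is
   real. *)
have [r r0 ->] : exists2 r : R, 0 < r & e = r%:C.
  have /complex_realP[r eE] : (e : R[i]) \is Num.real by exact: gtr0_real.
  by exists r => //; rewrite -ltcR -eE.
have r20 : 0 < r / 2 by rewrite divr_gt0.
move/cvgrPdist_lt/(_ _ r20): ua => ua; move/cvgrPdist_lt/(_ _ r20): ub => ub.
near=> n.
have hr : `|a - complex.Re (u n)| < r / 2 by near: n.
have hi : `|b - complex.Im (u n)| < r / 2 by near: n.
case: (u n) hr hi => x y /= hr hi.
have -> : (a +i* b - x +i* y : R[i]) = (a - x)%:C + 'i%C * (b - y)%:C.
  by apply/eqP; rewrite eq_complex /=; apply/andP; split; apply/eqP; ring.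
rewrite (le_lt_trans (ler_normD _ _))// normrM !normrE normc_i !normc_real.
by rewrite mul1r -rmorphD ltcR [ltRHS]splitr ltrD.
Unshelve. all: end_near. Qed.

(** The real and imaginary parts are additive and bounded by [normc], so each yields a real series
    that converges absolutely by comparison. *)
Lemma is_cvg_series_normc_geometric (R : realType) (K := R[i] : numFieldType)
    (u : nat -> K) (B r : R) : 0 <= r < 1 ->
  (forall n, normc (u n) <= B * r ^+ n) -> cvgn (series u).
Proof.
move=> /andP[r0 r1] uB.
have gB : cvgn (series (geometric B r)).
  by apply: is_cvg_geometric_series; rewrite ger0_norm.
have real_cvg (f : {additive R[i] -> R}) :
    (forall z, `|f z| <= normc z) -> cvgn (fun n => f (series u n)).
  move=> fle.
  have -> : (fun n => f (series u n)) = series (fun n => f (u n)).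
    by apply/funext => n; rewrite /series /= raddf_sum.
  apply: normed_cvg; apply: (series_le_cvg _ _ _ gB) => n /=.
  - exact: normr_ge0.
  - exact: le_trans (normc_ge0 _) (uB n).
  - exact: le_trans (fle _) (uB n).
apply: cvg_complex.
  exact: (real_cvg (@complex.Re R) (@normc_Re R)).
exact: (real_cvg (@complex.Im R) (@normc_Im R)).
Qed.

(** The terms do not tend to 0, so the series diverges and [limn] takes its default value 0. *)
Lemma dvg_series_normc_ge (R : realType) (K := R[i] : numFieldType)
    (u : nat -> K) (b : R) :
  0 < b -> (forall n, b <= normc (u n)) -> limn (series u) = 0.
Proof.
move=> b0 ub; apply: dvgP => /cvg_series_cvg_0.
move=> /cvgr0Pnorm_lt/(_ b%:C); rewrite ltcR => /(_ b0)[n _ /(_ n)] /=.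
by rewrite normrE ltcR leqnn ltNge ub => /(_ isT).
Qed.

Theorem theorem3 (R : realType) (q : R[i]) (x : R) (hq : `|q| < 1) :
  q_exp q ('i%C * x%:C) = q_cos q x%:C + 'i%C * q_sin q x%:C.
Proof.
have q1 : normc q < 1 by rewrite -ltcR -normrE.
have [B B0 termB] := q_exp_term_bounds q1.
set K := R[i] : numFieldType.
pose t z n : K := z ^+ n / q_fact q n.
pose c n : K := (-1) ^+ n * x%:C ^+ (2 * n) / q_fact q (2 * n).
pose s n : K := (-1) ^+ n * x%:C ^+ (2 * n + 1) / q_fact q (2 * n + 1).
have iX n : ('i%C : R[i]) ^+ (2 * n) = (-1) ^+ n by rewrite exprM sqr_i.
have tc n : t ('i%C * x%:C) (2 * n)%N = c n by rewrite /t exprMn iX.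
have ts n : t ('i%C * x%:C) (2 * n + 1)%N = 'i%C * s n.
  by rewrite /t exprMn exprD iX expr1 /s; ring.
(* Writing (-1)^n as i^(2n), of norm 1, compares all three series with the single sequence
   [t x%:C]. *)
have normc_c n : normc (c n) = normc (t x%:C (2 * n)%N).
  by rewrite /c -iX -mulrA normcM normcX normc_i expr1n mul1r.
have normc_s n : normc (s n) = normc (t x%:C (2 * n + 1)%N).
  by rewrite /s -iX -mulrA normcM normcX normc_i expr1n mul1r.
have normc_t n : normc (t ('i%C * x%:C) n) = normc (t x%:C n).
  by rewrite /t exprMn -mulrA normcM normcX normc_i expr1n mul1r.
set r := normc ((1 - q) * x%:C).
have r0 : 0 <= r := normc_ge0 _.
have tB n : B^-1 * r ^+ n <= normc (t x%:C n) <= B * r ^+ n := termB _ _.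
have [r1|r1] := ltP r 1; last first.
  have tb n : B^-1 <= normc (t x%:C n).
    have /andP[+ _] := tB n; apply: le_trans.
    by rewrite ler_peMr ?invr_ge0 ?(ltW B0)// exprn_ege1.
  have b0 : 0 < B^-1 by rewrite invr_gt0.
  rewrite /q_exp /q_cos /q_sin !(dvg_series_normc_ge b0) ?mulr0 ?addr0//.
  - by move=> n; rewrite normc_s.
  - by move=> n; rewrite normc_c.
  - by move=> n; rewrite normc_t.
(* The even and odd subseries have ratio r^2; since r^(2n+1) = r (r^2)^n, the constant for the odd
   one is B r. *)
have rr : 0 <= r ^+ 2 < 1 by rewrite exprn_ge0// exprn_ilt1.
have cc : cvgn (series c).
  apply: (@is_cvg_series_normc_geometric _ _ B _ rr) => n.
  by rewrite normc_c -exprM; have /andP[_] := tB (2 * n)%N.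
have cs : cvgn (series s).
  apply: (@is_cvg_series_normc_geometric _ _ (B * r) _ rr) => n.
  rewrite normc_s -exprM -mulrA -exprS -[(2 * n).+1]addn1.
  by have /andP[_] := tB (2 * n + 1)%N.
(* Limits being unique, it suffices that the series of e_q(ix) converges to the right-hand side;
   [cc] and [cs] say that the other two converge to their [limn]. *)
apply: cvg_lim; first exact: norm_hausdorff.
apply: (@cvg_series_even_odd _ K (t ('i%C * x%:C))).
  have -> : (fun k => t ('i%C * x%:C) (2 * k)%N) = c by apply/funext; exact: tc.
  exact: cc.
have -> : series (fun k => t ('i%C * x%:C) (2 * k + 1)%N) =
    (fun n => 'i%C * series s n : K).
  apply/funext => n; rewrite /series /= mulr_sumr.
  by apply: eq_bigr => k _; exact: ts.
exact: (@cvgMl_tmp K nat \oo _ (series s) 'i%C _ cs).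
Qed.
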